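(* Let $S$ be a semilattice-ordered semigroup. The join-bi-ideal closure operator $\mathcal{B}:\mathcal{P}(S)\to\mathcal{P}(S)$ is algebraic.
   Context: A semilattice-ordered semigroup is a triple $(S,\cdot,\lor)$ with $S$ nonempty, $(S,\cdot)$ a semigroup, $(S,\lor)$ a semilattice (commutative, associative, idempotent), and $x(y\lor z)=xy\lor xz$, $(x\lor y)z=xz\lor yz$ for all $x,y,z\in S$. It is partially ordered by $x\leqslant y\iff x\lor y=y$. For $A,B\subseteq S$, $AB=\{ab\mid a\in A,b\in B\}$. $\mathcal{P}(S)$ is the power set of $S$ and $\mathcal{P}_{\mathrm{fin}}(A)$ is the set of finite subsets of $A$. For $A\subseteq S$ put $\downarrow A=\{x\in S\mid\exists a\in A,\ x\leqslant a\}$ and $A^\lor=\{a_1\lor\ldots\lor a_n\mid n\geqslant1,\ a_i\in A\}$. A join-bi-ideal of $S$ is a (possibly empty) subset $B\subseteq S$ with $\downarrow B=B$, $B^\lor=B$, $BB\subseteq B$ and $BSB\subseteq B$. $\mathcal{B}(A)$ is the intersection of all join-bi-ideals of $S$ containing $A$, i.e. the smallest join-bi-ideal containing $A$; $A\mapsto\mathcal{B}(A)$ is a closure operator on $S$ (extensive, idempotent, order-preserving). A closure operator $\mathrm{cl}$ on $S$, written $A\mapsto A^{\mathrm{cl}}$, is algebraic if $A^{\mathrm{cl}}=\bigcup\{F^{\mathrm{cl}}\mid F\in\mathcal{P}_{\mathrm{fin}}(A)\}$ for every $A\subseteq S$. *)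

(* Defs.v *)
From HB Require Import structures.
From mathcomp Require Import all_boot all_order.
From mathcomp Require Import boolp classical_sets cardinality.

Set Implicit Arguments.
Unset Strict Implicit.
Unset Printing Implicit Defensive.

Local Open Scope classical_set_scope.

(* The order of a joinSemilatticeType is determined by its join:
   Order.JoinTheory.leEjoin is (x <= y) = (x `|` y == y). Conversely, a
   commutative, associative, idempotent join yields this structure through
   Order.POrder_Join_isSemilattice. The underlying choiceType is no restriction
   on S classically (boolp.gen_choiceMixin). *)
HB.mixin Record isSemilatticeOrderedSemigroup (d : Order.disp_t) S
    of Order.JoinSemilattice d S & Semigroup S := {
  slos_nonempty : inhabited S;
  mulg_joinr : forall x y z : S, (x * (y `|` z)%O = (x * y) `|` (x * z) :> S)%g%O;
  mulg_joinl : forall x y z : S, ((x `|` y)%O * z = (x * z) `|` (y * z) :> S)%g%O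
}.

#[short(type="semilatticeOrderedSemigroupType")]
HB.structure Definition SemilatticeOrderedSemigroup (d : Order.disp_t) :=
  { S of isSemilatticeOrderedSemigroup d S
       & Order.JoinSemilattice d S & Semigroup S }.

Section JoinBiIdeals.
Context {d : Order.disp_t} {S : semilatticeOrderedSemigroupType d}.
Implicit Types A B : set S.

Definition mulset A B : set S := [set (a * b)%g | a in A & b in B].

(* a_1 \/ ... \/ a_n with n >= 1, where a = a_1 and s = [:: a_2; ...; a_n]. *)
Definition joins A : set S :=
  [set x | exists a (s : seq S),
     [set` a :: s] `<=` A /\ x = foldl (@Order.join d S) a s].

Definition join_bi_ideal B : Prop :=
  [/\ down B = B, joins B = B, mulset B B `<=` B
    & mulset (mulset B setT) B `<=` B].

End JoinBiIdeals.

Record closure_operator (T : Type) := ClosureOperator {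
  closure_fun :> set T -> set T;
  closure_ext : forall A, A `<=` closure_fun A;
  closure_idem : forall A, closure_fun (closure_fun A) = closure_fun A;
  closure_mono : forall A B, A `<=` B -> closure_fun A `<=` closure_fun B
}.

Definition algebraic (T : Type) (cl : closure_operator T) : Prop :=
  forall A : set T,
    cl A = \bigcup_(F in [set F : set T | finite_set F /\ F `<=` A]) cl F.

Section JoinBiIdealClosure.
Context {d : Order.disp_t} (S : semilatticeOrderedSemigroupType d).
Implicit Types A B : set S.

Definition jbi_closure_fun A : set S := smallest join_bi_ideal A.

Lemma jbi_closure_ext A : A `<=` jbi_closure_fun A.
Proof. exact: sub_smallest. Qed.

Lemma jbi_closure_idem A :
  jbi_closure_fun (jbi_closure_fun A) = jbi_closure_fun A.
Proof.
apply/seteqP; split; last exact: jbi_closure_ext.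
by move=> x xA B [Bid AB]; apply: xA; split=> // y; apply.
Qed.

Lemma jbi_closure_mono A B :
  A `<=` B -> jbi_closure_fun A `<=` jbi_closure_fun B.
Proof.
move=> AB x xA C [Cid BC]; apply: xA; split=> //.
exact: subset_trans AB BC.
Qed.

Definition jbi_closure : closure_operator S :=
  ClosureOperator jbi_closure_ext jbi_closure_idem jbi_closure_mono.

End JoinBiIdealClosure.

(* Main.v *)
Require Import Defs.
From mathcomp Require Import all_boot all_order.
From mathcomp Require Import classical_sets cardinality.

(** The conditions defining a join-bi-ideal only ever ask that an element be
    present because finitely many (in fact at most two) others are: [x <= y]
    uses [y], while [x `|` y], [x * y] and [x * s * y] use [x] and [y], the
    middle factor [s] being an arbitrary element of the semigroup
    ([join_bi_idealP]).  A family of conditions of this kind passes from the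
    members of a directed family to its union: two elements of the union lie
    in a common member, which already contains what is required
    ([join_bi_ideal_bigcup]).

    The closures of the finite subsets of [A] form such a family, a member
    above those of [F] and [G] being the closure of [F `|` G].  Hence their
    union is a join-bi-ideal; it contains [A] because of the singletons, so it
    contains the closure of [A].  The other inclusion is monotonicity. *)

Set Implicit Arguments.
Unset Strict Implicit.
Unset Printing Implicit Defensive.

Local Open Scope classical_set_scope.

Section JoinBiIdealUnions.
Context {d : Order.disp_t} {S : semilatticeOrderedSemigroupType d}.
Implicit Types (A B : set S).

(** An iterated join of elements of [B] is a left fold, so closure under
    binary joins yields [joins B `<=` B] by induction; the equalities in the
    definition then reduce to inclusions, the others being automatic. *)
Lemma join_bi_idealP B :
  join_bi_ideal B <->
  [/\ forall x y, (x <= y)%O -> B y -> B x,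
      forall x y, B x -> B y -> B (x `|` y)%O,
      forall x y, B x -> B y -> B (x * y)%g
    & forall x z y, B x -> B y -> B (x * z * y)%g].
Proof.
split=> [[downB joinsB mulB sandB]|[leB joinB mulB sandB]].
  split=> [x y xy By|x y Bx By|x y Bx By|x z y Bx By].
  - by rewrite -downB; apply/downP; exists y.
  - rewrite -joinsB; exists x, [:: y]; split=> // z /=.
    by rewrite !inE => /orP[] /eqP ->.
  - by apply: mulB; exists x => //; exists y.
  - apply: sandB; exists (x * z)%g; last by exists y.
    by exists x => //; exists z.
split.
- apply/seteqP; split=> [x /downP[y By xy]|x Bx]; first exact: leB By.
  by apply/downP; exists x.
- apply/seteqP; split=> [_ [a [s [sB ->]]]|x Bx]; last first.
    by exists x, [::]; split=> // z /=; rewrite inE => /eqP ->.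
  elim: s a sB => [|b s IHs] a sB /=; first by apply: sB; rewrite /= inE.
  apply: IHs => z /=; rewrite inE => /orP[/eqP ->|zs].
    by apply: joinB; apply: sB; rewrite /= !inE eqxx ?orbT.
  by apply: sB; rewrite /= !inE zs !orbT.
- by move=> _ [x Bx [y By <-]]; apply: mulB.
- by move=> _ [_ [x Bx [z _ <-]] [y By <-]]; apply: sandB.
Qed.

Lemma join_bi_ideal_jbi_closure A : join_bi_ideal (jbi_closure S A).
Proof.
apply/join_bi_idealP; split.
- move=> x y xy Ay B [idB AB]; have /join_bi_idealP[leB _ _ _] := idB.
  by apply: leB xy _; apply: Ay.
- move=> x y Ax Ay B [idB AB]; have /join_bi_idealP[_ joinB _ _] := idB.
  by apply: joinB; [apply: Ax|apply: Ay].
- move=> x y Ax Ay B [idB AB]; have /join_bi_idealP[_ _ mulB _] := idB.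
  by apply: mulB; [apply: Ax|apply: Ay].
- move=> x z y Ax Ay B [idB AB]; have /join_bi_idealP[_ _ _ sandB] := idB.
  by apply: sandB; [apply: Ax|apply: Ay].
Qed.

(** Each closure condition has at most two premises about membership, so
    directedness places all of them in a single member of the family. *)
Lemma join_bi_ideal_bigcup (I : Type) (D : set I) (B : I -> set S) :
  (forall i, D i -> join_bi_ideal (B i)) ->
  (forall i j, D i -> D j ->
     exists2 k, D k & B i `<=` B k /\ B j `<=` B k) ->
  join_bi_ideal (\bigcup_(i in D) B i).
Proof.
move=> idB dirB.
have common x y : (\bigcup_(i in D) B i) x -> (\bigcup_(i in D) B i) y ->
    exists2 k, D k & B k x /\ B k y.
  move=> [i Di Bix] [j Dj Bjy]; have [k Dk [Bik Bjk]] := dirB i j Di Dj.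
  by exists k => //; split; [apply: Bik|apply: Bjk].
apply/join_bi_idealP; split.
- move=> x y xy [i Di Biy]; exists i => //.
  by have /join_bi_idealP[leB _ _ _] := idB i Di; apply: leB xy Biy.
- move=> x y /common /[apply] -[k Dk [Bkx Bky]]; exists k => //.
  by have /join_bi_idealP[_ joinB _ _] := idB k Dk; apply: joinB.
- move=> x y /common /[apply] -[k Dk [Bkx Bky]]; exists k => //.
  by have /join_bi_idealP[_ _ mulB _] := idB k Dk; apply: mulB.
- move=> x z y /common /[apply] -[k Dk [Bkx Bky]]; exists k => //.
  by have /join_bi_idealP[_ _ _ sandB] := idB k Dk; apply: sandB.
Qed.

End JoinBiIdealUnions.

Theorem proposition5p14 (d : Order.disp_t)
    (S : semilatticeOrderedSemigroupType d) :
  algebraic (jbi_closure S).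
Proof.
move=> A; apply/seteqP; split; last first.
  by move=> x [F [_ FA]]; apply: closure_mono FA x.
apply: smallest_sub.
  apply: join_bi_ideal_bigcup => [F _|F G [finF FA] [finG GA]].
    exact: join_bi_ideal_jbi_closure.
  exists (F `|` G).
    by split; [rewrite finite_setU|rewrite subUset].
  by split; apply: closure_mono; [apply: subsetUl|apply: subsetUr].
move=> x Ax; exists [set x]; last exact: closure_ext.
by split; [apply: finite_set1|move=> _ ->].
Qed.
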